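(* Let $c<d$ be real numbers with $0\le c$ (Case I) or $d\le 0$ (Case II), and let $\Omega^*=[c,d]$. There exist thresholds $\alpha_0\ge \max(c^2,d^2)/2$, $\alpha_0>0$, and $a_0>0$, depending only on $c,d$, such that the following holds for every $\alpha\ge\alpha_0$ and every interval $\Omega=[a,b]$, $a<b$. Let $f^+$ be a density on $\Omega$ with $f^+(x)>0$ for $x\in[a,b]$ and $\int_\Omega f^+dx=1$, let $f^-$ be a nonnegative density on $\Omega^*$ with $\int_{\Omega^*}f^-dx=1$, and let ${\bf s}^*$ be an optimal mapping for the Monge transfer problem from $f^+$ to $f^-$. Put $F(x):=\int_a^xf^+(t)\,dt$, $x\in[a,b]$. Case I. Suppose $0\le c<d<a<b$, $a\ge a_0$, $K^{\rm I}_\varepsilon>1$ for every $\varepsilon>0$, and ${\bf s}^*$ is strictly monotone with ${\bf s}^*(b)=d$ or ${\bf s}^*(a)=d$. Then there is a family (indexed by $\varepsilon>0$) of strictly increasing mappings ${\bf s}_\varepsilon:\Omega\to\Omega^*$ given explicitly by $${\bf s}_\varepsilon(x)=Q_\varepsilon^{-1}(F(x)),\quad x\in[a,b],$$ or, respectively, of strictly decreasing mappings ${\bf s}_\varepsilon:\Omega\to\Omega^*$ given explicitly by $${\bf s}_\varepsilon(x)=Q_\varepsilon^{-1}(1-F(x)),\quad x\in[a,b].$$ Case II. Suppose $a<b<c<d\le 0$, $b\le -a_0$, $K^{\rm II}_\varepsilon>1$ for every $\varepsilon>0$, and ${\bf s}^*$ is strictly monotone with ${\bf s}^*(a)=c$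 or ${\bf s}^*(b)=c$. Then there is a family (indexed by $\varepsilon>0$) of strictly increasing mappings ${\bf s}_\varepsilon:\Omega\to\Omega^*$ given explicitly by $${\bf s}_\varepsilon(x)=R_\varepsilon^{-1}(F(x)),\quad x\in[a,b],$$ or, respectively, of strictly decreasing mappings ${\bf s}_\varepsilon:\Omega\to\Omega^*$ given explicitly by $${\bf s}_\varepsilon(x)=R_\varepsilon^{-1}(1-F(x)),\quad x\in[a,b].$$
   Context: Monge transfer problem: an optimal mapping ${\bf s}^*$ minimizes $I[{\bf s}]=\int_\Omega|x-{\bf s}(x)|f^+(x)\,dx$ over the class of measurable one-to-one mappings ${\bf s}:\Omega\to\Omega^*$ driving $f^+$ to $f^-$ (i.e. pushing the measure $f^+dx$ forward to $f^-dy$). For $\varepsilon>0$, $E_\varepsilon(\gamma):=\gamma^2\ln(e^{\alpha^2}\gamma^{2\varepsilon})$ for $\gamma\in[e^{-\alpha^2/(2\varepsilon)},1]$; it is strictly increasing onto $[0,\alpha^2]$, and $E_\varepsilon^{-1}:[0,\alpha^2]\to[e^{-\alpha^2/(2\varepsilon)},1]$ is its inverse. Write $h_\varepsilon(\theta):=\theta/E_\varepsilon^{-1}(\theta^2)$ for $|\theta|\le\alpha$. Case I ($0\le c<d$): for $s\in[c,d)$ let $r_{\rm I}(s)\in(s^2/2,d^2/2)$ be the unique number with $\int_s^d h_\varepsilon(r_{\rm I}(s)-x^2/2)\,dx=0$. Set $K^{\rm I}_\varepsilon:=\int_c^d\int_d^y h_\varepsilon(r_{\rm I}(c)-x^2/2)\,dx\,dy$.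 When $K^{\rm I}_\varepsilon>1$, let $p^*_\varepsilon(d)\in[c,d)$ be the unique $s$ for which the function $y\mapsto\int_d^y h_\varepsilon(r_{\rm I}(s)-x^2/2)\,dx$ on $[s,d]$ has integral $1$ over $[s,d]$, and let $\bar u_\varepsilon$ be that function for $s=p^*_\varepsilon(d)$; it is positive on $(p^*_\varepsilon(d),d)$. Define $Q_\varepsilon(y):=\int_{p^*_\varepsilon(d)}^y\bar u_\varepsilon(t)\,dt$ for $y\in[p^*_\varepsilon(d),d]$, with inverse $Q_\varepsilon^{-1}:[0,1]\to[p^*_\varepsilon(d),d]$. Case II ($c<d\le0$): for $t\in(c,d]$ let $r_{\rm II}(t)\in(t^2/2,c^2/2)$ be the unique number with $\int_c^t h_\varepsilon(x^2/2-r_{\rm II}(t))\,dx=0$. Set $K^{\rm II}_\varepsilon:=\int_c^d\int_c^y h_\varepsilon(x^2/2-r_{\rm II}(d))\,dx\,dy$. When $K^{\rm II}_\varepsilon>1$, let $q^*_\varepsilon(c)\in(c,d]$ be the unique $t$ for which the function $y\mapsto\int_c^y h_\varepsilon(x^2/2-r_{\rm II}(t))\,dx$ on $[c,t]$ has integral $1$ over $[c,t]$, and let $\bar u_\varepsilon$ be that function for $t=q^*_\varepsilon(c)$; it is positive on $(c,q^*_\varepsilon(c))$. Define $R_\varepsilon(y):=\int_c^y\bar u_\varepsilon(t)\,dt$ for $y\in[c,q^*_\varepsilon(c)]$, with inverse $R_\varepsilon^{-1}:[0,1]\to[c,q^*_\varepsilon(c)]$. *)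

(* Defs.v *)
From HB Require Import structures.
From mathcomp Require Import all_boot all_order all_algebra.
From mathcomp Require Import all_classical all_reals all_analysis.

Set Implicit Arguments.
Unset Strict Implicit.
Unset Printing Implicit Defensive.

Import Order.TTheory GRing.Theory Num.Theory.
Import numFieldNormedType.Exports.

Local Open Scope classical_set_scope.
Local Open Scope ring_scope.

(* The unique element of P; the junk value 0 unless P is a singleton. *)
Definition the_unique (R : realType) (P : set R) : R :=
  xget 0 [set x | unique P x].

(* The integral of f from a to b, with the usual sign change when b < a. *)
Definition oint (R : realType) (a b : R) (f : R -> R) : R :=
  if a <= b then \int[lebesgue_measure]_(x in `[a, b]) f x
  else - \int[lebesgue_measure]_(x in `[b, a]) f x.

(* Measurability is with respect to the Borel sigma-algebra. *)
Definition is_density (R : realType) (A : set R) (f : R -> R) : Prop :=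
  [/\ measurable_fun A f, (forall x, A x -> 0 <= f x) &
      (\int[lebesgue_measure]_(x in A) (f x)%:E = 1)%E].

(* s maps the measure fp dx on A to the measure fm dy on B. *)
Definition pushes (R : realType) (A B : set R) (fp fm s : R -> R) : Prop :=
  forall D : set R, measurable D ->
    (\int[lebesgue_measure]_(x in A `&` s @^-1` D) (fp x)%:E =
     \int[lebesgue_measure]_(y in B `&` D) (fm y)%:E)%E.

Definition transport_map (R : realType) (A B : set R) (fp fm s : R -> R) :
    Prop :=
  [/\ measurable_fun A s, set_fun A B s, set_inj A s & pushes A B fp fm s].

Definition monge_cost (R : realType) (A : set R) (fp s : R -> R) : \bar R :=
  (\int[lebesgue_measure]_(x in A) (`|x - s x| * fp x)%:E)%E.

Definition optimal_map (R : realType) (A B : set R) (fp fm s : R -> R) : Prop :=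
  transport_map A B fp fm s /\
  forall s', transport_map A B fp fm s' ->
    (monge_cost A fp s <= monge_cost A fp s')%E.

Definition increasing_on (R : realType) (A : set R) (s : R -> R) : Prop :=
  {in A &, {homo s : x y / x < y}}.

Definition decreasing_on (R : realType) (A : set R) (s : R -> R) : Prop :=
  {in A &, {homo s : x y /~ x < y}}.

Definition strictly_monotone_on (R : realType) (A : set R) (s : R -> R) :
    Prop :=
  increasing_on A s \/ decreasing_on A s.

Definition E (R : realType) (alpha eps gamma : R) : R :=
  gamma ^+ 2 * ln (expR (alpha ^+ 2) * gamma `^ (2 * eps)).

(* E alpha eps increases strictly from 0 to alpha ^+ 2 on this interval; outside
   the range [0, alpha ^+ 2] the value of Einv is junk. *)
Definition Einv (R : realType) (alpha eps : R) : R -> R :=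
  'pinv_(fun=> 0) `[expR (- (alpha ^+ 2 / (2 * eps))), 1] (E alpha eps).

Definition h (R : realType) (alpha eps theta : R) : R :=
  theta / Einv alpha eps (theta ^+ 2).

(* Only used for 0 <= s < d <= Num.sqrt (2 * alpha), where the arguments of h
   lie in [-alpha, alpha] and hence those of Einv in E's range [0, alpha ^+ 2]. *)

Definition rI (R : realType) (alpha eps d s : R) : R :=
  the_unique [set r | s ^+ 2 / 2 < r < d ^+ 2 / 2 /\
    oint s d (fun x => h alpha eps (r - x ^+ 2 / 2)) = 0].

Definition uI (R : realType) (alpha eps d s y : R) : R :=
  oint d y (fun x => h alpha eps (rI alpha eps d s - x ^+ 2 / 2)).

Definition KI (R : realType) (alpha eps c d : R) : R :=
  oint c d (uI alpha eps d c).

Definition pstar (R : realType) (alpha eps c d : R) : R :=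
  the_unique [set s | c <= s < d /\ oint s d (uI alpha eps d s) = 1].

Definition Q (R : realType) (alpha eps c d y : R) : R :=
  oint (pstar alpha eps c d) y (uI alpha eps d (pstar alpha eps c d)).

Definition Qinv (R : realType) (alpha eps c d : R) : R -> R :=
  'pinv_(fun=> 0) `[pstar alpha eps c d, d] (Q alpha eps c d).

(* Mirror image of the above, only used for c < t <= 0. *)

Definition rII (R : realType) (alpha eps c t : R) : R :=
  the_unique [set r | t ^+ 2 / 2 < r < c ^+ 2 / 2 /\
    oint c t (fun x => h alpha eps (x ^+ 2 / 2 - r)) = 0].

Definition uII (R : realType) (alpha eps c t y : R) : R :=
  oint c y (fun x => h alpha eps (x ^+ 2 / 2 - rII alpha eps c t)).

Definition KII (R : realType) (alpha eps c d : R) : R :=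
  oint c d (uII alpha eps c d).

Definition qstar (R : realType) (alpha eps c d : R) : R :=
  the_unique [set t | c < t <= d /\ oint c t (uII alpha eps c t) = 1].

Definition Rmap (R : realType) (alpha eps c d y : R) : R :=
  oint c y (uII alpha eps c (qstar alpha eps c d)).

Definition Rmapinv (R : realType) (alpha eps c d : R) : R -> R :=
  'pinv_(fun=> 0) `[c, qstar alpha eps c d] (Rmap alpha eps c d).

(* Main.v *)
(* h is the restriction to [- alpha, alpha] of the inverse of the odd expanding
   map v |-> v expR ((v ^ 2 - alpha ^ 2) / (2 eps)), so it extends to an odd,
   strictly increasing, Lipschitz function H on the whole line.  The balance
   \int_s^d H (r - x ^ 2 / 2) dx is strictly increasing in r, hence has a unique
   zero r(s), which depends continuously on s.  The profile
   u_s y = \int_d^y H (r(s) - x ^ 2 / 2) dx is positive on ]s, d[ and decreases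
   with s, so its mass \int_s^d u_s is strictly decreasing in s; integrating by
   parts expresses this mass through r(s) and the primitive of H, which shows
   that it is continuous and tends to 0 as s tends to d.  So the mass takes the
   value 1 exactly once, Q is a strictly increasing bijection from [p*, d] to
   [0, 1], and Q^-1 composed with F or 1 - F has the required properties.
   Case II is the mirror image x |-> - x of Case I. *)

Require Import Defs.
From HB Require Import structures.
From mathcomp Require Import all_boot all_order all_algebra.
From mathcomp Require Import all_classical all_reals all_analysis.
From mathcomp Require Import measurable_realfun.
From mathcomp Require Import lra.

Set Implicit Arguments.
Unset Strict Implicit.
Unset Printing Implicit Defensive.

Import Order.TTheory GRing.Theory Num.Theory.
Import numFieldNormedType.Exports.

Local Open Scope classical_set_scope.
Local Open Scope ring_scope.

(** * Signed integrals of continuous functions, handled through primitives *)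

Section primitives.
Variable R : realType.
Implicit Types (f g F : R -> R) (a b c : R).
Local Notation mu := (@lebesgue_measure R).

Lemma is_derive_continuous F f :
  (forall x : R, is_derive x 1 F (f x)) -> continuous F.
Proof.
move=> dF x; apply: differentiable_continuous; apply/derivable1_diffP.
by case: (dF x).
Qed.

Lemma continuous_integrable f a b : continuous f ->
  mu.-integrable `[a, b] (EFin \o f).
Proof.
move=> cf; apply: continuous_compact_integrable; first exact: segment_compact.
exact: continuous_subspaceT.
Qed.

Lemma oint_primitive f F a b : continuous f ->
  (forall x : R, is_derive x 1 F (f x)) -> oint a b f = F b - F a.
Proof.
move=> cf dF; have cF := is_derive_continuous dF.
have lt_case u v : u < v -> \int[mu]_(x in `[u, v]) f x = F v - F u.
  move=> uv; rewrite /Rintegral (@continuous_FTC2 _ f F)//.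
  - exact: continuous_subspaceT.
  - split=> [x _|//|//].
    + by case: (dF x).
    + exact/cvg_at_right_filter/cF.
    + exact/cvg_at_left_filter/cF.
  - by move=> x _; rewrite derive1E; apply: derive_val.
rewrite /oint; case: ltgtP => [ab|ba|<-]; first exact: lt_case.
- by rewrite lt_case// opprB.
- by rewrite set_itv1 Rintegral_set1 subrr.
Qed.

Lemma primitive_exists f : continuous f ->
  exists F, forall x : R, is_derive x 1 F (f x).
Proof.
move=> cf; exists (fun x => oint 0 x f) => x.
(* The base point lies strictly to the left of both 0 and [x], so the fundamental theorem applies at
   [x], and near [x] both branches of [oint] become [G y - G 0]. *)
pose a := Num.min 0 x - 1.
have a0 : a < 0.
  by rewrite /a (le_lt_trans (_ : _ <= 0 - 1)) ?lerB ?ge_min ?lexx//; lra.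
have ax : a < x.
  rewrite /a (le_lt_trans (_ : _ <= x - 1)) ?lerB ?ge_min ?lexx ?orbT//.
  by lra.
pose G (y : R) := \int[mu]_(t in `[a, y]) f t.
have GB u v : a < u -> u <= v -> \int[mu]_(t in `[u, v]) f t = G v - G u.
  move=> au uv; rewrite /G Rintegral_itvB ?bnd_simp ?(ltW au)//; last first.
    exact: continuous_integrable.
  rewrite Rintegral_itv_obnd_cbnd//.
  apply: integrableS (continuous_integrable u v cf) => //.
  exact: subset_itv_oc_cc.
apply: (@near_eq_is_derive _ _ _ (fun y => G y - G 0)).
- near=> y; have ay : a < y by near: y; exact: lt_nbhsr.
  by rewrite /oint; case: leP => [y0|y0]; rewrite GB// ?opprB// ltW.
- have xx1 : x < x + 1 by rewrite ltrDl.
  have [dG G'] := continuous_FTC1_closed xx1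
    (continuous_integrable a (x + 1) cf) ax (cf x).
  rewrite -[f x]subr0; apply: is_deriveB.
  by split=> //; rewrite -derive1E.
Unshelve. all: by end_near. Qed.

Lemma is_derive_oint f a : continuous f ->
  forall x : R, is_derive x 1 (fun y => oint a y f) (f x).
Proof.
move=> cf x; have [F dF] := primitive_exists cf.
rewrite (_ : (fun y => _) = (fun y => F y - F a)); last first.
  by apply/funext => y; apply: oint_primitive.
by rewrite -[f x]subr0; apply: is_deriveB.
Qed.

Lemma oint_continuous f a : continuous f -> continuous (fun y => oint a y f).
Proof. by move=> cf; apply: is_derive_continuous (is_derive_oint a cf). Qed.

Lemma oint_chasles f a b c : continuous f ->
  oint a b f + oint b c f = oint a c f.
Proof.
move=> cf; have [F dF] := primitive_exists cf.
by rewrite !(oint_primitive _ _ cf dF); lra.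
Qed.

Lemma oint_id f a : oint a a f = 0.
Proof. by rewrite /oint lexx set_itv1 Rintegral_set1. Qed.

Lemma oint_swap f a b : oint a b f = - oint b a f.
Proof.
by rewrite /oint; case: ltgtP => // [_|->]; rewrite ?opprK//
  set_itv1 Rintegral_set1 oppr0.
Qed.

Lemma ointN f a b : continuous f -> oint a b (fun x => - f x) = - oint a b f.
Proof.
move=> cf; have [F dF] := primitive_exists cf.
rewrite (oint_primitive _ _ cf dF) (@oint_primitive _ (fun x => - F x)).
- by lra.
- by move=> x; apply: cvgN; exact: cf.
Qed.

Lemma ointB f g a b : continuous f -> continuous g ->
  oint a b (fun x => f x - g x) = oint a b f - oint a b g.
Proof.
move=> cf cg; have [F dF] := primitive_exists cf.
have [G dG] := primitive_exists cg.
rewrite (oint_primitive _ _ cf dF) (oint_primitive _ _ cg dG).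
rewrite (@oint_primitive _ (fun x => F x - G x)).
- by lra.
- by move=> x; apply: cvgB; [exact: cf|exact: cg].
Qed.

Lemma oint_reflect f a b : continuous f ->
  oint a b (fun x => f (- x)) = oint (- b) (- a) f.
Proof.
move=> cf; have [F dF] := primitive_exists cf.
have dG (x : R) : is_derive x 1 (fun y => - F (- y)) (f (- x)).
  have dFN : is_derive x 1 (F \o -%R) (f (- x) * - 1).
    exact: (@is_derive1_comp _ F -%R x).
  by have := is_deriveN dFN; rewrite mulrN1 opprK.
rewrite (oint_primitive _ _ cf dF) (oint_primitive _ _ _ dG); first by lra.
by move=> x; apply: continuous_comp; [exact: opp_continuous|exact: cf].
Qed.

(** The mean value theorem for a primitive. Signs and Lipschitz bounds of integrals are read off at
    the single point [c]. *)
Lemma oint_mean f a b : continuous f -> a < b ->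
  exists2 c, a < c < b & oint a b f = f c * (b - a).
Proof.
move=> cf ab; have [F dF] := primitive_exists cf.
have [|c] := @MVT R F f a b ab (fun x _ => dF x).
  exact/continuous_subspaceT/is_derive_continuous.
by rewrite in_itv /= => cab E; exists c => //;
  rewrite (oint_primitive _ _ cf dF).
Qed.

Lemma oint_gt0 f a b : continuous f -> a < b ->
  (forall x : R, a < x < b -> 0 < f x) -> 0 < oint a b f.
Proof.
move=> cf ab f0; have [c cab ->] := oint_mean cf ab.
by rewrite mulr_gt0 ?f0// subr_gt0.
Qed.

Lemma oint_lt0 f a b : continuous f -> a < b ->
  (forall x : R, a < x < b -> f x < 0) -> oint a b f < 0.
Proof.
move=> cf ab f0; have [c cab ->] := oint_mean cf ab.
by rewrite nmulr_rlt0 ?f0// subr_gt0.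
Qed.

Lemma lt_oint f g a b : continuous f -> continuous g -> a < b ->
  (forall x : R, a < x < b -> f x < g x) -> oint a b f < oint a b g.
Proof.
move=> cf cg ab fg; rewrite -subr_gt0 -ointB//; apply: oint_gt0 => //.
- by move=> x; apply: cvgB; [exact: cg|exact: cf].
- by move=> x xab; rewrite subr_gt0 fg.
Qed.

(** Agreement between the endpoints suffices; this lets [h] be replaced by its extension where its
    arguments stay in range. *)
Lemma eq_oint f g a b :
  (forall x : R, Num.min a b <= x <= Num.max a b -> f x = g x) ->
  oint a b f = oint a b g.
Proof.
rewrite /oint; case: leP => _ fg; last congr (- _);
  by apply: eq_Rintegral => x; rewrite inE /= in_itv /=; exact: fg.
Qed.

End primitives.

(** * Continuity criteria *)

Lemma lipschitz_homo_continuous (R : realType) (f : R -> R) (L : R) :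
  (forall x y, x <= y -> 0 <= f y - f x <= L * (y - x)) -> continuous f.
Proof.
move=> fL x; apply/cvgrPdist_lt => e e0.
have L0 : 0 <= L by have /andP[] := fL 0 1 ler01; lra.
near=> y.
(* The denominator [L + 1] covers the case [L = 0]. *)
have : `|x - y| < e / (L + 1).
  by near: y; apply: cvgr_dist_lt => //; rewrite divr_gt0//; lra.
have L1 : 0 < L + 1 by lra.
rewrite ltr_pdivlMr//.
case: (leP x y) => [xy|/ltW yx].
  have /andP[f0 f1] := fL _ _ xy.
  by rewrite (distrC x) (distrC (f x)) !ger0_norm// ?subr_ge0//; lra.
have /andP[f0 f1] := fL _ _ yx.
by rewrite !ger0_norm// ?subr_ge0//; lra.
Unshelve. all: by end_near. Qed.

(* The zero of a family of strictly increasing functions depends continuously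
   on the parameter: it stays between r - e and r + e as long as the signs at
   these two points do not change. *)
Lemma zero_continuous (R : realType) (Phi : R -> R -> R) (rho : R -> R)
    (s0 : R) :
  (\forall s \near s0, Phi s (rho s) = 0) ->
  (\forall s \near s0, {homo Phi s : x y / x < y}) ->
  (forall r, {for s0, continuous (Phi^~ r)}) -> {for s0, continuous rho}.
Proof.
move=> rho0 inc cPhi; apply/cvgrPdist_lt => e e0.
have P0 := nbhs_singleton rho0; have i0 := nbhs_singleton inc.
near=> s.
have Ps : Phi s (rho s) = 0 by near: s.
have is_ : {homo Phi s : x y / x < y} by near: s.
have mono := leW_mono (le_mono is_).
have lo : Phi s (rho s0 - e) < 0.
  near: s; apply: (cvgr_lt _ (cPhi _)); rewrite -P0; apply: i0; lra.
have hi : 0 < Phi s (rho s0 + e).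
  near: s; apply: (cvgr_gt _ (cPhi _)); rewrite -P0; apply: i0; lra.
move: lo hi; rewrite -Ps !mono ltr_distl => lo hi.
by apply/andP; split; lra.
Unshelve. all: by end_near. Qed.

Lemma sqr_half_continuous (R : realType) (r : R) :
  continuous (fun x : R => r - x ^+ 2 / 2).
Proof.
move=> x; apply: cvgB; first exact: cvg_cst.
by apply: cvgMl; exact: exprn_continuous.
Qed.

(** * Balance, profile and mass for a strictly increasing Lipschitz function vanishing at 0 *)

Section profile.
Variables (R : realType) (H : R -> R) (L : R).
Implicit Types c d r s t x y : R.
Hypothesis H_inc : {homo H : x y / x < y}.
Hypothesis H0 : H 0 = 0.
Hypothesis H_lip : forall x y, x <= y -> H y - H x <= L * (y - x).

Let w r x := H (r - x ^+ 2 / 2).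

Let H_mono : {mono H : x y / x <= y}. Proof. exact: le_mono. Qed.

Let H_gt0 x : 0 < x -> 0 < H x. Proof. by rewrite -{2}H0; exact: H_inc. Qed.

Let H_lt0 x : x < 0 -> H x < 0. Proof. by rewrite -{2}H0; exact: H_inc. Qed.

Let H_ge0 x : 0 <= x -> 0 <= H x. Proof. by rewrite -{2}H0 H_mono. Qed.

Let H_le0 x : x <= 0 -> H x <= 0. Proof. by rewrite -{2}H0 H_mono. Qed.

Let H_cont : continuous H.
Proof.
apply: (@lipschitz_homo_continuous _ _ L) => x y xy.
by rewrite subr_ge0 H_mono xy H_lip.
Qed.

Let w_cont r : continuous (w r).
Proof.
by move=> x; apply: continuous_comp; [exact: sqr_half_continuous|exact: H_cont].
Qed.

Lemma balance_inc s d : s < d -> {homo (fun r => oint s d (w r)) : x y / x < y}.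
Proof.
by move=> sd x y xy; apply: lt_oint => // z _; apply: H_inc; rewrite ltrD2r.
Qed.

Let balance_cont s d : s < d -> continuous (fun r => oint s d (w r)).
Proof.
move=> sd; apply: (@lipschitz_homo_continuous _ _ (L * (d - s))) => x y xy.
have cxy : continuous (fun z => w y z - w x z).
  by move=> z; apply: cvgB; exact: w_cont.
rewrite -ointB//; have [z _ ->] := oint_mean cxy sd.
have le_z : x - z ^+ 2 / 2 <= y - z ^+ 2 / 2 by rewrite lerD2r.
apply/andP; split.
  by rewrite mulr_ge0 ?subr_ge0 ?H_mono// ltW.
rewrite mulrAC; apply: ler_wpM2r; first by rewrite subr_ge0 ltW.
apply: le_trans (H_lip le_z) _.
by rewrite opprD addrACA subrr addr0.
Qed.

(** Unlike in [rI], the root is not confined to an interval: [H] lives on the whole line, so for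
    [s < d] there is exactly one root anyway. *)
Definition balance d s := xget 0 [set r | oint s d (w r) = 0].

Lemma balanceP s d : s < d -> oint s d (w (balance d s)) = 0.
Proof.
move=> sd; have [r r0] : exists r, oint s d (w r) = 0.
  (* At [r = 0] the integrand is nonpositive. For [z] in [s, d], [z ^+ 2] is at most [d ^+ 2] or at
     most [s ^+ 2], according to the sign of [z], so at [r = B] the integrand is nonnegative. *)
  pose B := (s ^+ 2 + d ^+ 2) / 2.
  have s2 := sqr_ge0 s; have d2 := sqr_ge0 d.
  have B0 : 0 <= B by rewrite /B; lra.
  have [||r _ r0] := @IVT R (fun r => oint s d (w r)) 0 B 0 B0.
  - exact/continuous_subspaceT/balance_cont.
  - rewrite ge_min le_max; apply/andP; split; apply/orP; [left|right].
      have [z _ ->] := oint_mean (@w_cont 0) sd.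
      rewrite mulr_le0_ge0 ?subr_ge0 ?(ltW sd)//; apply: H_le0.
      by have := sqr_ge0 z; lra.
    have [z /andP[sz zd] ->] := oint_mean (@w_cont B) sd.
    rewrite mulr_ge0 ?subr_ge0 ?(ltW sd)//; apply: H_ge0; rewrite /B.
    have [z0|z0] := leP 0 z.
      by have : 0 <= (d - z) * (d + z) by [apply: mulr_ge0; lra]; lra.
    by have : 0 <= (z - s) * (- z - s) by [apply: mulr_ge0; lra]; lra.
  - by exists r.
by rewrite /balance; case: xgetP => [_ -> //|/(_ r)].
Qed.

Lemma balance_uniq s d r : s < d -> oint s d (w r) = 0 -> balance d s = r.
Proof.
move=> sd r0; apply: (inc_inj (le_mono (balance_inc sd))).
by rewrite balanceP.
Qed.

(** Outside these bounds the argument of [H] keeps one strict sign on ]s, d[, and the integral could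
    not vanish. *)
Lemma balance_itv s d : 0 <= s -> s < d ->
  s ^+ 2 / 2 < balance d s < d ^+ 2 / 2.
Proof.
move=> s0 sd; have b0 := balanceP sd; apply/andP; split; rewrite ltNge;
  apply/negP => le_b.
- have : oint s d (w (balance d s)) < 0.
    by apply: oint_lt0 => // x /andP[sx xd]; apply: H_lt0; nra.
  by rewrite b0 ltxx.
- have : 0 < oint s d (w (balance d s)).
    by apply: oint_gt0 => // x /andP[sx xd]; apply: H_gt0; nra.
  by rewrite b0 ltxx.
Qed.

Lemma balance_cont_param s d : s < d -> {for s, continuous (balance d)}.
Proof.
move=> sd.
apply: (@zero_continuous _ (fun s r => oint s d (w r))).
- by near=> t; apply: balanceP; near: t; exact: lt_nbhsl.
- by near=> t; apply: balance_inc; near: t; exact: lt_nbhsl.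
- move=> r; rewrite (_ : (fun _ => _) = (fun t => - oint d t (w r))); last first.
    by apply/funext => t; rewrite oint_swap.
  by apply: cvgN; exact: oint_continuous.
Unshelve. all: by end_near. Qed.

Definition profile d s y := oint d y (w (balance d s)).

Lemma profile_cont d s : continuous (profile d s).
Proof. exact: oint_continuous. Qed.

(** The integrand changes sign once, from positive to negative. Beyond the change the profile is
    minus an integral of negative values over [y, d]; before it, the balance condition turns the
    profile into an integral of positive values over [s, y]. *)
Lemma profile_gt0 d s y : 0 <= s -> s < y < d -> 0 < profile d s y.
Proof.
move=> s0 /andP[sy yd]; have sd := lt_trans sy yd.
have [le_b|lt_b] := leP (balance d s) (y ^+ 2 / 2).
- rewrite /profile oint_swap oppr_gt0.
  by apply: oint_lt0 => // x /andP[yx xd]; apply: H_lt0; nra.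
- rewrite /profile -(@oint_chasles _ _ d s y)// oint_swap balanceP// oppr0 add0r.
  by apply: oint_gt0 => // x /andP[sx xy]; apply: H_gt0; nra.
Qed.

Definition mass d s := oint s d (profile d s).

(** Moving the left end from [s] to [t] loses the positive mass over [s, t] and also lowers the
    profile on ]t, d[, because the balance value rises. *)
Lemma mass_decr d s t : 0 <= s -> s < t -> t < d -> mass d t < mass d s.
Proof.
move=> s0 st td; have sd := lt_trans st td.
(* Over [t, d] the integral for [balance d s] equals [- profile d s t], which is negative, while the
   one for [balance d t] is 0. *)
have lt_b : balance d s < balance d t.
  rewrite -(leW_mono (le_mono (balance_inc td))) (balanceP td).
  rewrite oint_swap oppr_lt0; apply: profile_gt0 => //.
  by rewrite st td.
rewrite /mass -[ltRHS](@oint_chasles _ _ s t d); last exact: profile_cont.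
rewrite -[ltLHS]add0r ltrD//.
- apply: oint_gt0 => //; first exact: profile_cont.
  by move=> x /andP[sx xt]; rewrite profile_gt0// sx (lt_trans xt).
- apply: lt_oint => //; [exact: profile_cont|exact: profile_cont|].
  move=> x /andP[tx xd]; rewrite /profile oint_swap [ltRHS]oint_swap ltrN2.
  exact: balance_inc.
Qed.

(* Integration by parts: y * profile y + P (balance - y ^ 2 / 2), where P is the
   primitive of H, is a primitive of the profile, and the profile vanishes at
   both ends. *)
Lemma massE d s : s < d -> mass d s =
  oint 0 (balance d s - d ^+ 2 / 2) H - oint 0 (balance d s - s ^+ 2 / 2) H.
Proof.
move=> sd; set r := balance d s; pose P x := oint 0 x H.
pose G (y : R) := y * profile d s y + P (r - y ^+ 2 / 2).
have dG (y : R) : is_derive y 1 G (profile d s y).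
  have dp := is_derive_oint d (@w_cont r) y.
  have dP := is_derive_oint 0 H_cont (r - y ^+ 2 / 2).
  have dq : is_derive y 1 (fun y : R => r - y ^+ 2 / 2) (- y).
    by apply: is_derive_eq; rewrite /GRing.scale /=; lra.
  have dPq : is_derive y 1 (P \o (fun y : R => r - y ^+ 2 / 2)) (w r y * - y).
    exact: (@is_derive1_comp _ P (fun y : R => r - y ^+ 2 / 2) y).
  have dyp : is_derive y 1 (id * profile d s) (y *: w r y + profile d s y *: 1).
    exact: is_deriveM.
  have := is_deriveD dyp dPq.
  rewrite (_ : _ + w r y * - y = profile d s y)//.
  by rewrite /GRing.scale /=; lra.
rewrite /mass (oint_primitive _ _ (@profile_cont d s) dG) /G.
rewrite [profile d s d]oint_id [profile d s s]oint_swap balanceP// -/r /P.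
by rewrite oppr0 !mulr0 !add0r.
Qed.

Lemma mass_cont s d : s < d -> {for s, continuous (mass d)}.
Proof.
move=> sd; pose P x := oint 0 x H.
have cP := @oint_continuous _ _ 0 H_cont.
have cb := balance_cont_param sd.
have cm : (fun t => P (balance d t - d ^+ 2 / 2) - P (balance d t - t ^+ 2 / 2))
    t @[t --> s] --> mass d s.
  rewrite massE//; apply: cvgB.
    apply: (@continuous_comp _ _ _ (fun t => balance d t - d ^+ 2 / 2) P);
      last exact: cP.
    by apply: cvgB; [exact: cb|exact: cvg_cst].
  apply: (@continuous_comp _ _ _ (fun t => balance d t - t ^+ 2 / 2) P);
    last exact: cP.
  apply: cvgB; first exact: cb.
  by apply: cvgMl; exact: exprn_continuous.
apply: cvg_trans cm; apply: near_eq_cvg.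
(* The closed formula is available only for [t < d], hence for [t] near [s]. *)
by near=> t; rewrite massE//; near: t; exact: lt_nbhsl.
Unshelve. all: by end_near. Qed.

(** The primitive [P] of [H] is nonnegative and nonincreasing on the negative axis. Dropping the
    subtracted term in [massE] and using [s ^+ 2 / 2 < balance d s] bounds the mass by
    [P (s ^+ 2 / 2 - d ^+ 2 / 2)], which tends to [P 0 = 0]. *)
Lemma mass_lt1 c d : 0 <= c -> c < d -> exists2 s, c < s < d & mass d s < 1.
Proof.
move=> c0 cd; pose P x := oint 0 x H.
have P_ge0 x : 0 <= P x.
  case: (ltgtP 0 x) => [x0|x0|<-]; last by rewrite /P oint_id.
    by apply/ltW/oint_gt0 => // z /andP[z0 _]; exact: H_gt0.
  rewrite /P oint_swap oppr_ge0.
  by apply/ltW/oint_lt0 => // z /andP[_ z0]; exact: H_lt0.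
have P_anti x y : x < y -> y <= 0 -> P y <= P x.
  move=> xy y0; rewrite -subr_le0 /P (oint_swap H 0 x) opprK addrC.
  rewrite oint_chasles//.
  by apply/ltW/oint_lt0 => // z /andP[xz zy]; apply: H_lt0;
    exact: lt_le_trans y0.
have cP := @oint_continuous _ _ 0 H_cont.
have near_d : \forall s \near d, P (s ^+ 2 / 2 - d ^+ 2 / 2) < 1.
  have : P (s ^+ 2 / 2 - d ^+ 2 / 2) @[s --> d] --> P (d ^+ 2 / 2 - d ^+ 2 / 2).
    apply: (@continuous_comp _ _ _ (fun s : R => s ^+ 2 / 2 - d ^+ 2 / 2) P).
      apply: cvgB; last exact: cvg_cst.
      by apply: cvgMl; exact: exprn_continuous.
    exact: cP.
  rewrite subrr [P 0]oint_id => /cvgr_lt; apply.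
  by rewrite ltr01.
have [s [cs sd Ps]] : exists s,
    [/\ c < s, s < d & P (s ^+ 2 / 2 - d ^+ 2 / 2) < 1].
  near d^'- => s; exists s; split; near: s.
  - exact: nbhs_left_gt.
  - exact: nbhs_left_lt.
  - exact: cvg_within near_d.
exists s; first by rewrite cs.
have s0 : 0 <= s by lra.
have /andP[b_gt b_lt] := balance_itv s0 sd.
apply: le_lt_trans Ps; rewrite massE//.
apply: (@le_trans _ _ (P (balance d s - d ^+ 2 / 2))); last first.
  by apply: P_anti; lra.
by rewrite lerBlDr lerDl P_ge0.
Unshelve. all: by end_near. Qed.

(** Continuity of the mass is established only to the left of [d], so the intermediate value theorem
    is applied on [c, s] with [s] from [mass_lt1]. *)
Lemma mass_eq1 c d : 0 <= c -> c < d -> 1 < mass d c ->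
  exists2 p, c <= p < d & mass d p = 1.
Proof.
move=> c0 cd m1; have [s /andP[cs sd] ms] := mass_lt1 c0 cd.
have [||p] := @IVT R (mass d) c s 1 (ltW cs).
- apply: continuous_in_subspaceT => x; rewrite inE /= in_itv /= => /andP[_ xs].
  exact: mass_cont (le_lt_trans xs sd).
- rewrite ge_min le_max.
  by apply/andP; split; apply/orP; [right|left]; exact: ltW.
- rewrite in_itv /= => /andP[cp ps] mp; exists p => //.
  by rewrite cp (le_lt_trans ps).
Qed.

End profile.

(** * The function [h] as the restriction of a globally defined inverse *)

Section constitutive.
Variables (R : realType) (alpha eps : R).
Hypothesis eps0 : 0 < eps.

(* With v = h theta and gamma = expR ((v ^ 2 - alpha ^ 2) / (2 eps)) one has
   E gamma = (v gamma) ^ 2, hence theta = v gamma. *)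
Definition hinv (v : R) := v * expR ((v ^+ 2 - alpha ^+ 2) / (2 * eps)).

Definition hext (t : R) : R := xget 0 [set v | hinv v = t].

(** The least value of the exponential factor of [hinv], attained at 0; it serves as expansion
    constant. *)
Let m := expR (- alpha ^+ 2 / (2 * eps)).

Let eps20 : 0 < 2 * eps. Proof. by rewrite mulr_gt0. Qed.

Lemma hinvN v : hinv (- v) = - hinv v.
Proof. by rewrite /hinv sqrrN mulNr. Qed.

(** On the nonnegative axis the exponential factor increases and is at least [m]; oddness gives the
    nonpositive axis; for opposite signs each endpoint is bounded separately. This yields strict
    monotonicity of [hinv] and a Lipschitz inverse. *)
Lemma hinv_expand x y : x <= y -> m * (y - x) <= hinv y - hinv x.
Proof.
have m_le v : m <= expR ((v ^+ 2 - alpha ^+ 2) / (2 * eps)).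
  by rewrite ler_expR ler_pM2r ?invr_gt0// lerDr sqr_ge0.
have pos x' y' : 0 <= x' -> x' <= y' -> m * (y' - x') <= hinv y' - hinv x'.
  move=> x0 xy; rewrite /hinv.
  set a := expR _; set b := expR _.
  have ba : b <= a.
    rewrite ler_expR ler_pM2r ?invr_gt0// lerD2r ler_sqr// nnegrE.
    exact: le_trans xy.
  have ma : m <= a := m_le y'.
  have : x' * b <= x' * a by apply: ler_wpM2l.
  have : m * (y' - x') <= a * (y' - x') by apply: ler_wpM2r; rewrite ?subr_ge0.
  lra.
move=> xy; have [x0|x0] := leP 0 x; first exact: pos.
have [y0|y0] := leP y 0.
  have := @pos (- y) (- x); rewrite !hinvN oppr_ge0 lerN2 => /(_ y0 xy).
  lra.
rewrite /hinv; set a := expR _; set b := expR _.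
have ma : m <= a := m_le y.
have mb : m <= b := m_le x.
have : m * y <= a * y by apply: ler_wpM2r => //; exact: ltW.
have : b * x <= m * x by apply: ler_wnM2r => //; exact: ltW.
lra.
Qed.

Let m_gt0 : 0 < m. Proof. exact: expR_gt0. Qed.

Let hinv_inc : {homo hinv : x y / x < y}.
Proof.
move=> x y xy; rewrite -subr_gt0.
apply: lt_le_trans (hinv_expand (ltW xy)).
by rewrite mulr_gt0// subr_gt0.
Qed.

Let hinv_mono : {mono hinv : x y / x <= y}. Proof. exact: le_mono. Qed.

Let hinv_cont : continuous hinv.
Proof.
move=> x; apply: cvgM; first exact: cvg_id.
apply: (@cvg_comp _ _ _ (fun v => (v ^+ 2 - alpha ^+ 2) / (2 * eps)) expR);
  last exact: continuous_expR.
apply: cvgMl; apply: cvgB; last exact: cvg_cst.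
exact: exprn_continuous.
Qed.

Lemma hextK : cancel hext hinv.
Proof.
move=> t; have [v vt] : exists v, hinv v = t.
  (* With this [M], expansion from 0 gives [hinv M] at least the absolute value of [t]. *)
  pose M := `|t| / m; have M0 : 0 <= M by rewrite divr_ge0// ltW.
  have hinv0 : hinv 0 = 0 by rewrite /hinv mul0r.
  have hM : `|t| <= hinv M.
    have := hinv_expand M0; rewrite hinv0 !subr0 /M mulrCA divff ?mulr1//.
    by rewrite lt0r_neq0.
  have [|||v _ vt] := @IVT R hinv (- M) M t.
  - by lra.
  - exact: continuous_subspaceT.
  - rewrite hinvN ge_min le_max; move: hM; rewrite ler_norml => /andP[tM Mt].
    by apply/andP; split; apply/orP; [left; lra|right].
  - by exists v.
by rewrite /hext; case: xgetP => [_ -> //|/(_ v)].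
Qed.

Lemma hinvK : cancel hinv hext.
Proof. by move=> v; apply: (inc_inj hinv_mono); rewrite hextK. Qed.

Lemma hext_inc : {homo hext : x y / x < y}.
Proof.
by move=> x y; rewrite -{1}(hextK x) -{1}(hextK y) (leW_mono hinv_mono).
Qed.

Lemma hext0 : hext 0 = 0.
Proof. by rewrite -[RHS]hinvK /hinv mul0r. Qed.

Lemma hextN t : hext (- t) = - hext t.
Proof. by rewrite -{1}(hextK t) -hinvN hinvK. Qed.

Lemma hext_lipschitz x y : x <= y -> hext y - hext x <= m^-1 * (y - x).
Proof.
move=> xy; rewrite ler_pdivlMl//.
rewrite -{2}(hextK x) -{2}(hextK y); apply: hinv_expand.
by rewrite -hinv_mono !hextK.
Qed.

Let E_expR u :
  E alpha eps (expR u) = expR u ^+ 2 * (alpha ^+ 2 + 2 * eps * u).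
Proof. by rewrite /E -expRM -expRD expRK [u * _]mulrC. Qed.

(** With gamma = expR u, the factor [alpha ^+ 2 + 2 * eps * u] is nonnegative on this interval and
    strictly increasing, and it is multiplied by a positive increasing factor. *)
Let E_inj :
  {in `[expR (- (alpha ^+ 2 / (2 * eps))), 1] &, injective (E alpha eps)}.
Proof.
suff E_lt : {in `[expR (- (alpha ^+ 2 / (2 * eps))), 1] &,
    {homo E alpha eps : x y / x < y}}.
  move=> x y xI yI Exy; case: (ltgtP x y) => // /E_lt.
    by move=> /(_ xI yI); rewrite Exy ltxx.
  by move=> /(_ yI xI); rewrite Exy ltxx.
move=> x y; rewrite !in_itv /= => /andP[lx _] /andP[ly _] xy.
have x0 : 0 < x := lt_le_trans (expR_gt0 _) lx.
have y0 : 0 < y := lt_le_trans (expR_gt0 _) ly.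
rewrite -(@lnK _ x) ?posrE// in lx xy *.
rewrite -(@lnK _ y) ?posrE// in ly xy *.
move: lx ly xy; rewrite !ler_expR ltr_expR !E_expR.
set u := ln x; set v := ln y => lu lv uv.
have Lu : 0 <= alpha ^+ 2 + 2 * eps * u.
  by move: lu; rewrite lerNl ler_pdivlMr//; lra.
have : 2 * eps * u < 2 * eps * v by rewrite ltr_pM2l.
move=> epsuv.
apply: (@lt_le_trans _ _ (expR u ^+ 2 * (alpha ^+ 2 + 2 * eps * v))).
  by rewrite ltr_pM2l ?exprn_gt0 ?expR_gt0// ltrD2l.
apply: ler_wpM2r; first by lra.
by rewrite ler_sqr ?nnegrE ?expR_ge0// ler_expR ltW.
Qed.

Lemma h_hext t : - alpha <= t <= alpha -> h alpha eps t = hext t.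
Proof.
move=> /andP[t_ge t_le]; rewrite -{1}[t]hextK; set v := hext t.
(* As [hinv] fixes [alpha] and [- alpha], the value [v] stays in [- alpha, alpha]. *)
have hinv_alpha : hinv alpha = alpha.
  by rewrite /hinv subrr mul0r expR0 mulr1.
have v_le : v <= alpha by rewrite -hinv_mono hextK hinv_alpha.
have v_ge : - alpha <= v by rewrite -hinv_mono hextK hinvN hinv_alpha.
have v2 : v ^+ 2 <= alpha ^+ 2.
  by rewrite -subr_ge0 subr_sqr mulr_ge0//; lra.
(* [expR u] is the preimage of the squared argument under [E]; the bound on [v ^+ 2] places it in
   the domain of [Einv], and dividing [hinv v] by it leaves [v]. *)
set u := (v ^+ 2 - alpha ^+ 2) / (2 * eps).
have Eu : E alpha eps (expR u) = hinv v ^+ 2.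
  rewrite E_expR /hinv -/u exprMn mulrC; congr (_ * _).
  by rewrite /u mulrCA divff ?mulr1 ?lt0r_neq0//; lra.
rewrite /h -Eu /Einv pinvKV.
- by rewrite /hinv -/u mulfK// gt_eqF// expR_gt0.
- by move=> x y /set_mem xI /set_mem yI; exact: E_inj.
- apply/mem_set; rewrite /= in_itv /=; apply/andP; split.
    by rewrite ler_expR -mulNr /u ler_pM2r ?invr_gt0// lerDr sqr_ge0.
  by rewrite -expR0 ler_expR /u pmulr_lle0 ?invr_gt0// subr_le0.
Qed.

End constitutive.

(** * Partial inverses of functions increasing on a segment *)

Section inverse.
Variables (R : realType) (f g : R -> R) (p q : R).
Hypotheses (pq : p <= q) (fg : {in `[p, q], f =1 g}) (cg : continuous g).
Hypothesis g_inc : {in `[p, q] &, {homo g : x y / x < y}}.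

(** Here [f] stands for a map built from [h] and [g] for its globally continuous counterpart built
    from [hext]; the intermediate value theorem is applied to [g]. *)
Let f_surj : set_surj `[p, q] `[g p, g q] f.
Proof.
move=> t; rewrite /= in_itv /= => /andP[gt tg].
have [||y yI gy] := @IVT R g p q t pq.
- exact: continuous_subspaceT.
- by rewrite ge_min le_max gt tg orbT.
- by exists y => //; rewrite fg.
Qed.

Let g_pinv t : t \in `[g p, g q] -> let y := 'pinv_(fun=> 0) `[p, q] f t in
  y \in `[p, q] /\ g y = t.
Proof.
move=> tI y.
have yI : y \in `[p, q].
  by have := @surjpinv_image_sub _ _ (fun=> 0) _ _ _ f_surj; apply; exists t.
split=> //; rewrite -fg//.
by have := @surjpK _ _ (fun=> 0) _ _ _ f_surj; apply; rewrite inE.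
Qed.

Lemma pinv_itv t : t \in `[g p, g q] -> 'pinv_(fun=> 0) `[p, q] f t \in `[p, q].
Proof. by move=> /g_pinv[]. Qed.

Lemma pinv_inc :
  {in `[g p, g q] &, {homo 'pinv_(fun=> 0) `[p, q] f : x y / x < y}}.
Proof.
move=> s t /g_pinv[sI gs] /g_pinv[tI gt] st.
rewrite ltNge le_eqVlt; apply/negP => /predU1P[ts|/g_inc].
  by move: st; rewrite -gs -gt ts ltxx.
by move=> /(_ tI sI); rewrite gs gt ltNge (ltW st).
Qed.

End inverse.

Lemma the_uniqueP (R : realType) (P : set R) x :
  P x -> (forall y, P y -> x = y) -> the_unique P = x.
Proof.
move=> Px Puniq; rewrite /the_unique.
by case: xgetP => [y -> [_ /(_ _ Px)]|/(_ x)[]].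
Qed.

(** * Identification of Cases I and II with balance, profile and mass *)

Section cases.
Variables (R : realType) (alpha eps : R).
Implicit Types a b c d p r s t x y z : R.
Hypothesis eps0 : 0 < eps.

Let H := hext alpha eps.
Let L := (expR (- alpha ^+ 2 / (2 * eps)))^-1.
Let H_inc : {homo H : x y / x < y} := hext_inc alpha eps0.
Let H0 : H 0 = 0 := hext0 alpha eps0.
Let H_lip : forall x y, x <= y -> H y - H x <= L * (y - x) :=
  hext_lipschitz alpha eps0.

Let w r x := H (r - x ^+ 2 / 2).

Let w_cont r : continuous (w r).
Proof.
move=> x; apply: continuous_comp; first exact: sqr_half_continuous.
apply: (@lipschitz_homo_continuous _ _ L) => u v uv.
by rewrite subr_ge0 (le_mono H_inc) uv H_lip.
Qed.

Let pr := profile H.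
Let pr_cont d s : continuous (pr d s) :=
  @profile_cont _ _ _ H_inc H_lip d s.

(** Both [r] and [x ^+ 2 / 2] lie in [0, alpha], so their difference is in the range where [h] and
    [hext] agree. *)
Let h_w d r x : d ^+ 2 / 2 <= alpha -> 0 <= r <= d ^+ 2 / 2 ->
  x ^+ 2 <= d ^+ 2 -> h alpha eps (r - x ^+ 2 / 2) = w r x.
Proof.
move=> da /andP[r0 rd] xd; apply: h_hext => //.
by have := sqr_ge0 x; lra.
Qed.

Lemma mass_inj d s t : 0 <= s < d -> 0 <= t < d ->
  mass H d s = mass H d t -> s = t.
Proof.
move=> /andP[s0 sd] /andP[t0 td] st; case: (ltgtP s t) => [lt_st|lt_st|-> //].
- by have := mass_decr H_inc H0 H_lip s0 lt_st td; rewrite st ltxx.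
- by have := mass_decr H_inc H0 H_lip t0 lt_st sd; rewrite st ltxx.
Qed.

Lemma oint_profile_gt0 d p y z : 0 <= p -> p <= y -> y < z -> z <= d ->
  0 < oint y z (pr d p).
Proof.
move=> p0 py yz zd; apply: oint_gt0 => // x /andP[yx xz].
by apply: (profile_gt0 H_inc H0 H_lip) => //; lra.
Qed.

Section caseI.
Variable d : R.
Hypothesis d_le : d ^+ 2 / 2 <= alpha.

Lemma oint_h r a b : 0 <= r <= d ^+ 2 / 2 -> 0 <= a <= d -> 0 <= b <= d ->
  oint a b (fun x => h alpha eps (r - x ^+ 2 / 2)) = oint a b (w r).
Proof.
move=> rd /andP[a0 ad] /andP[b0 bd]; apply: eq_oint => x /andP[mx xM].
apply: (h_w d_le rd).
have x0 : 0 <= x by apply: le_trans mx; rewrite le_min a0.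
have xd : x <= d by apply: le_trans xM _; rewrite ge_max ad.
by rewrite ler_sqr ?nnegrE//; exact: le_trans xd.
Qed.

(** The root for [H] meets the bounds in [rI] by [balance_itv]; conversely those bounds keep every
    candidate in the range where [h] is [H]. *)
Lemma rI_balance s : 0 <= s -> s < d -> rI alpha eps d s = balance H d s.
Proof.
move=> s0 sd; have b_itv := balance_itv H_inc H0 H_lip s0 sd.
have sI : 0 <= s <= d by rewrite s0 ltW.
have dI : 0 <= d <= d by rewrite lexx andbT (le_trans s0 (ltW sd)).
have rd r : s ^+ 2 / 2 < r < d ^+ 2 / 2 -> 0 <= r <= d ^+ 2 / 2.
  by have := sqr_ge0 s; lra.
apply: the_uniqueP => [|r /= [/rd r_itv]].
  split=> //; rewrite oint_h//; first exact: (balanceP H_inc H0 H_lip).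
  exact: rd.
by rewrite oint_h//; exact: (balance_uniq H_inc H0 H_lip).
Qed.

Lemma uI_profile s y : 0 <= s -> s < d -> s <= y <= d ->
  uI alpha eps d s y = pr d s y.
Proof.
move=> s0 sd syd; rewrite /uI rI_balance// oint_h//; last 2 first.
- by lra.
- by lra.
- have := balance_itv H_inc H0 H_lip s0 sd.
  by have := sqr_ge0 s; lra.
Qed.

Lemma oint_uI s y : 0 <= s -> s < d -> s <= y <= d ->
  oint s y (uI alpha eps d s) = oint s y (pr d s).
Proof.
move=> s0 sd /andP[sy yd]; apply: eq_oint => x.
rewrite min_l// max_r// => /andP[sx xy].
by rewrite uI_profile// sx (le_trans xy).
Qed.

(** [KI] is the mass at [c], so [mass_eq1] supplies [p]; strict decrease of the mass makes it the
    unique candidate for [pstar]. *)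
Lemma Q_primitive c : 0 <= c -> c < d -> 1 < KI alpha eps c d ->
  exists p, [/\ c <= p < d, pstar alpha eps c d = p, mass H d p = 1 &
    {in `[p, d], forall y, Q alpha eps c d y = oint p y (pr d p)}].
Proof.
move=> c0 cd; rewrite /KI oint_uI ?(ltW cd) ?lexx// => m1.
have [p /andP[cp pd] mp] := mass_eq1 H_inc H0 H_lip c0 cd m1.
have p0 := le_trans c0 cp.
have pE : pstar alpha eps c d = p.
  apply: the_uniqueP => [|s /= [/andP[cs sd]]].
    split; first by rewrite cp.
    by rewrite oint_uI ?(ltW pd) ?lexx.
  have s0 := le_trans c0 cs.
  rewrite oint_uI ?(ltW sd) ?lexx// => ms.
  apply: (@mass_inj d); [by rewrite p0|by rewrite s0|].
  exact: etrans mp (esym ms).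
exists p; split; [by rewrite cp|exact: pE|exact: mp|].
by move=> y; rewrite in_itv /= => yI; rewrite /Q pE (oint_uI p0 pd yI).
Qed.

Lemma Qinv_spec c : 0 <= c -> c < d -> 1 < KI alpha eps c d ->
  (forall t, t \in `[0, 1] -> Qinv alpha eps c d t \in `[c, d]) /\
  {in `[0, 1] &, {homo Qinv alpha eps c d : x y / x < y}}.
Proof.
move=> c0 cd /(Q_primitive c0 cd)[p [/andP[cp pd] pE mp QE]].
have p0 := le_trans c0 cp.
pose g y := oint p y (pr d p).
have cg : continuous g by exact: oint_continuous.
have g_inc : {in `[p, d] &, {homo g : x y / x < y}}.
  move=> x y; rewrite !in_itv /= => /andP[px xd] /andP[py yd] xy.
  rewrite /g -(@oint_chasles _ _ p x y)// ltrDl.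
  exact: oint_profile_gt0.
have gp : g p = 0 by rewrite /g oint_id.
have gd : g d = 1 by [].
rewrite /Qinv pE; split=> [t tI|].
- have : 'pinv_(fun=> 0) `[p, d] (Q alpha eps c d) t \in `[p, d].
    by apply: (@pinv_itv _ _ g _ _ (ltW pd) QE cg); rewrite gp gd.
  by rewrite !in_itv /= => /andP[pt ->]; rewrite (le_trans cp).
- by have := @pinv_inc _ _ g _ _ (ltW pd) QE cg g_inc; rewrite gp gd.
Qed.

End caseI.

Section caseII.
Variable c : R.
Hypothesis c_le : c ^+ 2 / 2 <= alpha.

(** Oddness of [hext] reverses the sign of the argument, and the reflection of [x] moves the
    integral to the nonnegative axis, with [- c] in the role of [d]. *)
Lemma oint_hN r a b : 0 <= r <= c ^+ 2 / 2 -> c <= a <= 0 -> c <= b <= 0 ->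
  oint a b (fun x => h alpha eps (x ^+ 2 / 2 - r)) = - oint (- b) (- a) (w r).
Proof.
move=> /andP[r0 rc] /andP[ca a0] /andP[cb b0].
rewrite -oint_reflect// -ointN; last first.
  by move=> x; apply: continuous_comp; [exact: opp_continuous|exact: w_cont].
apply: eq_oint => x /andP[mx xM].
have x0 : x <= 0 by apply: le_trans xM _; rewrite ge_max a0.
have cx : c <= x by apply: le_trans mx; rewrite le_min ca.
rewrite /w sqrrN -hextN// opprB h_hext//.
have x2 : x ^+ 2 <= c ^+ 2.
  rewrite -[x ^+ 2]sqrrN -[c ^+ 2]sqrrN ler_sqr ?nnegrE ?oppr_ge0// ?lerN2//.
  exact: le_trans x0.
by move: c_le (sqr_ge0 x); lra.
Qed.

Lemma rII_balance t : c < t -> t <= 0 ->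
  rII alpha eps c t = balance H (- c) (- t).
Proof.
move=> ct t0; have Nt0 : 0 <= - t by rewrite oppr_ge0.
have Ntc : - t < - c by rewrite ltrN2.
have := balance_itv H_inc H0 H_lip Nt0 Ntc; rewrite !sqrrN => b_itv.
have rd r : t ^+ 2 / 2 < r < c ^+ 2 / 2 -> 0 <= r <= c ^+ 2 / 2.
  by have := sqr_ge0 t; lra.
have cI : c <= c <= 0 by rewrite lexx (le_trans (ltW ct)).
have tI : c <= t <= 0 by rewrite t0 ltW.
apply: the_uniqueP => [|r /= [/rd r_itv]].
  split=> //; rewrite oint_hN ?rd// (balanceP H_inc H0 H_lip)//.
  exact: oppr0.
rewrite oint_hN// => /eqP; rewrite oppr_eq0 => /eqP.
exact: (balance_uniq H_inc H0 H_lip).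
Qed.

Lemma uII_profile t y : c < t -> t <= 0 -> c <= y <= t ->
  uII alpha eps c t y = pr (- c) (- t) (- y).
Proof.
move=> ct t0 cyt; rewrite /uII rII_balance// oint_hN//; last 2 first.
- by lra.
- by lra.
- by rewrite -oint_swap.
- have Nt0 : 0 <= - t by rewrite oppr_ge0.
  have Ntc : - t < - c by rewrite ltrN2.
  have := balance_itv H_inc H0 H_lip Nt0 Ntc; rewrite !sqrrN.
  by have := sqr_ge0 t; lra.
Qed.

Lemma oint_uII t y : c < t -> t <= 0 -> c <= y <= t ->
  oint c y (uII alpha eps c t) = oint (- y) (- c) (pr (- c) (- t)).
Proof.
move=> ct t0 /andP[cy yt]; rewrite -(oint_reflect _ _ (@pr_cont _ _)).
apply: eq_oint => x.
rewrite min_l// max_r// => /andP[cx xy].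
by rewrite uII_profile// cx (le_trans xy).
Qed.

(** The point [p] is a left end in the reflected picture, where [- d] and [- c] replace [c] and [d];
    reflecting back gives [qstar]. *)
Lemma Rmap_primitive d : c < d -> d <= 0 -> 1 < KII alpha eps c d ->
  exists p, [/\ - d <= p < - c, qstar alpha eps c d = - p, mass H (- c) p = 1 &
    {in `[c, - p], forall y,
      Rmap alpha eps c d y = oint (- y) (- c) (pr (- c) p)}].
Proof.
move=> cd d0; rewrite /KII oint_uII ?(ltW cd) ?lexx// => m1.
have Nd0 : 0 <= - d by rewrite oppr_ge0.
have Ndc : - d < - c by rewrite ltrN2.
have [p /andP[dp pc] mp] := mass_eq1 H_inc H0 H_lip Nd0 Ndc m1.
have p0 := le_trans Nd0 dp.
have cp : c < - p by rewrite ltrNr.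
have Np0 : - p <= 0 by rewrite oppr_le0.
have qE : qstar alpha eps c d = - p.
  apply: the_uniqueP => [|t /= [/andP[ct td]]].
    split; first by rewrite cp lerNl.
    rewrite (oint_uII cp Np0) ?opprK; first exact: mp.
    by rewrite lexx ltW.
  have t0 := le_trans td d0.
  rewrite oint_uII ?(ltW ct) ?lexx// => mt.
  rewrite -[t]opprK; congr (- _).
  apply: (@mass_inj (- c)); [by rewrite p0|by rewrite oppr_ge0 t0 ltrN2|].
  exact: etrans mp (esym mt).
exists p; split; [by rewrite dp|exact: qE|exact: mp|].
by move=> y; rewrite in_itv /= => yI;
  rewrite /Rmap qE (oint_uII cp Np0 yI) opprK.
Qed.

Lemma Rmapinv_spec d : c < d -> d <= 0 -> 1 < KII alpha eps c d ->
  (forall t, t \in `[0, 1] -> Rmapinv alpha eps c d t \in `[c, d]) /\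
  {in `[0, 1] &, {homo Rmapinv alpha eps c d : x y / x < y}}.
Proof.
move=> cd d0 /(Rmap_primitive cd d0)[p [/andP[dp pc] qE mp RE]].
have p0 : 0 <= p by lra.
have cp : c <= - p by lra.
pose g y := oint (- y) (- c) (pr (- c) p).
have cg : continuous g.
  rewrite (_ : g = fun y => - oint (- c) (- y) (pr (- c) p)); last first.
    by apply/funext => y; rewrite /g oint_swap.
  move=> y; apply: cvgN.
  apply: (@cvg_comp _ _ _ -%R (fun z => oint (- c) z (pr (- c) p))).
    exact: opp_continuous.
  exact: oint_continuous.
(* As [y] grows, the lower end [- y] moves down, adding the positive mass over [- y, - x]. *)
have g_inc : {in `[c, - p] &, {homo g : x y / x < y}}.
  move=> x y; rewrite !in_itv /= => /andP[cx xp] /andP[cy yp] xy.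
  rewrite /g -(@oint_chasles _ _ (- y) (- x))// ltrDr.
  by apply: oint_profile_gt0 => //; lra.
have gc : g c = 0 by rewrite /g oint_id.
have gp : g (- p) = 1 by rewrite /g opprK.
rewrite /Rmapinv qE; split=> [t tI|].
- have : 'pinv_(fun=> 0) `[c, - p] (Rmap alpha eps c d) t \in `[c, - p].
    by apply: (@pinv_itv _ _ g _ _ cp RE cg); rewrite gc gp.
  by rewrite !in_itv /= => /andP[-> tp]; rewrite (le_trans tp)// lerNl.
- by have := @pinv_inc _ _ g _ _ cp RE cg g_inc; rewrite gc gp.
Qed.

End caseII.

End cases.

(** * The distribution function of a positive density *)

Section distribution.
Variables (R : realType) (a b : R) (fp : R -> R).
Hypotheses (dens : is_density `[a, b] fp)
  (fp_gt0 : forall x, x \in `[a, b] -> 0 < fp x).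

Let F (x : R) := \int[lebesgue_measure]_(t in `[a, x]) fp t.

Let fp_int : (@lebesgue_measure R).-integrable `[a, b] (EFin \o fp).
Proof.
case: dens => mf f0 f1; apply/integrableP; split; first exact/measurable_EFinP.
rewrite (_ : \int[_]_(x in _) _ = 1)%E ?ltry// -f1.
by apply: eq_integral => x; rewrite inE => /f0 fx0; rewrite /= ger0_norm.
Qed.

(** If [F] did not grow from [x] to [y], the nonnegative [fp] would vanish almost everywhere on ]x,
    y], contradicting pointwise positivity on a set of positive length. *)
Lemma distribution_inc : {in `[a, b] &, {homo F : x y / x < y}}.
Proof.
move=> x y; rewrite !in_itv /= => /andP[ax xb] /andP[ay yb] xy.
have sub_ay : `[a, y] `<=` `[a, b] by exact: subset_itvl.
have sub_xy : `]x, y] `<=` `[a, b].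
  by move=> z; rewrite /= !in_itv /= => /andP[xz zy]; apply/andP; split; lra.
have int_xy : (@lebesgue_measure R).-integrable `]x, y] (EFin \o fp).
  apply: (integrableS (mu := lebesgue_measure) _ _ sub_xy fp_int);
    exact: measurable_itv.
rewrite -subr_gt0 /F Rintegral_itvB ?bnd_simp ?(ltW xy)//; last first.
  apply: (integrableS (mu := lebesgue_measure) _ _ sub_ay fp_int);
    exact: measurable_itv.
have ge0 : 0 <= \int[lebesgue_measure]_(t in `]x, y]) fp t.
  by apply: Rintegral_ge0 => z /sub_xy zab; apply/ltW/fp_gt0.
rewrite lt_neqAle ge0 andbT; apply/eqP => int0.
have /integrableP[mf _] := int_xy.
have : (\int[lebesgue_measure]_(t in `]x, y]) `|(EFin \o fp) t| = 0)%E.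
  transitivity (\int[lebesgue_measure]_(t in `]x, y]) (fp t)%:E)%E.
    apply: eq_integral => z; rewrite inE => /sub_xy zab.
    by rewrite /= gtr0_norm// fp_gt0.
  rewrite -[LHS]fineK; first by congr EFin; exact: esym int0.
  apply: (integrable_fin_num (mu := lebesgue_measure) _ int_xy).
  exact: measurable_itv.
move=> /(ae_eq_integral_abs _ _ mf)[].
  exact: measurable_itv.
(* The null set [N] contains every point of ]x, y] where [fp] is nonzero, that is, all of ]x, y]. *)
move=> N [mN N0 subN].
have : (lebesgue_measure `]x, y] <= lebesgue_measure N)%E.
  apply: le_measure; rewrite ?inE//.
  move=> z zxy; apply: subN => /= /(_ zxy)[fz0].
  by have := fp_gt0 (sub_xy _ zxy); rewrite fz0 ltxx.
rewrite N0 lebesgue_measure_itv /= lte_fin xy -EFinB lee_fin.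
by rewrite leNgt subr_gt0 xy.
Qed.

Lemma distribution_itv x : x \in `[a, b] -> F x \in `[0, 1].
Proof.
move=> xI; rewrite in_itv /=; apply/andP; split.
  apply: Rintegral_ge0 => z /= zI; apply/ltW/fp_gt0.
  by move: xI zI; rewrite !in_itv /= => /andP[_ xb] /andP[-> /le_trans->].
have Fb : F b = 1 by case: dens => _ _ int1; rewrite /F /Rintegral int1.
move: (xI); rewrite in_itv /= => /andP[ax xb].
move: xb; rewrite le_eqVlt => /predU1P[->|xb]; first by rewrite Fb.
rewrite -Fb ltW//; apply: distribution_inc => //.
by rewrite in_itv /= lexx andbT (le_trans ax (ltW xb)).
Qed.

End distribution.

(** * Choice of the thresholds and assembly of the four families of mappings *)

Theorem theorem1p3 (R : realType) (c d : R) (hcd : c < d)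
    (hsign : 0 <= c \/ d <= 0) :
  exists alpha0 a0 : R,
    [/\ Num.max (c ^+ 2) (d ^+ 2) / 2 <= alpha0, 0 < alpha0, 0 < a0 &
    forall (alpha a b : R) (fp fm sstar : R -> R),
    let F := fun x => \int[lebesgue_measure]_(t in `[a, x]) fp t in
    alpha0 <= alpha -> a < b ->
    is_density `[a, b] fp -> (forall x, x \in `[a, b] -> 0 < fp x) ->
    is_density `[c, d] fm ->
    optimal_map `[a, b] `[c, d] fp fm sstar ->
    (0 <= c -> d < a -> a0 <= a ->
      (forall eps, 0 < eps -> 1 < KI alpha eps c d) ->
      strictly_monotone_on `[a, b] sstar ->
      (sstar b = d ->
        exists s : R -> R -> R, forall eps, 0 < eps ->
          [/\ set_fun `[a, b] `[c, d] (s eps),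
              increasing_on `[a, b] (s eps) &
              forall x, x \in `[a, b] -> s eps x = Qinv alpha eps c d (F x)]) /\
      (sstar a = d ->
        exists s : R -> R -> R, forall eps, 0 < eps ->
          [/\ set_fun `[a, b] `[c, d] (s eps),
              decreasing_on `[a, b] (s eps) &
              forall x, x \in `[a, b] ->
                s eps x = Qinv alpha eps c d (1 - F x)])) /\
    (d <= 0 -> b < c -> b <= - a0 ->
      (forall eps, 0 < eps -> 1 < KII alpha eps c d) ->
      strictly_monotone_on `[a, b] sstar ->
      (sstar a = c ->
        exists s : R -> R -> R, forall eps, 0 < eps ->
          [/\ set_fun `[a, b] `[c, d] (s eps),
              increasing_on `[a, b] (s eps) &
              forall x, x \in `[a, b] ->
                s eps x = Rmapinv alpha eps c d (F x)]) /\
      (sstar b = c ->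
        exists s : R -> R -> R, forall eps, 0 < eps ->
          [/\ set_fun `[a, b] `[c, d] (s eps),
              decreasing_on `[a, b] (s eps) &
              forall x, x \in `[a, b] ->
                s eps x = Rmapinv alpha eps c d (1 - F x)]))].
Proof.
have M0 : 0 < Num.max (c ^+ 2) (d ^+ 2).
  rewrite lt_max; case: hsign => [c0|d0]; apply/orP; [right|left].
    by rewrite exprn_gt0// (le_lt_trans c0).
  have c0 : c < 0 := lt_le_trans hcd d0.
  by rewrite exprn_even_gt0 //= lt_eqF.
(* The least permitted [alpha0]; it already gives [c ^+ 2 / 2 <= alpha] and [d ^+ 2 / 2 <= alpha],
   which keep the arguments of [h] in range. *)
exists (Num.max (c ^+ 2) (d ^+ 2) / 2), 1.
split; [exact: lexx|by rewrite divr_gt0|exact: ltr01|].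
move=> alpha a b fp fm sstar F alpha_ge _ dens fp_gt0 _ _.
have F01 x : x \in `[a, b] -> F x \in `[0, 1].
  exact: distribution_itv.
have F_inc : {in `[a, b] &, {homo F : x y / x < y}}.
  exact: distribution_inc.
have NF01 x : x \in `[a, b] -> 1 - F x \in `[0, 1].
  by move=> /F01; rewrite !in_itv /= subr_ge0 gerBl => /andP[-> ->].
have c2 : c ^+ 2 / 2 <= alpha.
  by apply: le_trans alpha_ge; rewrite ler_pM2r ?invr_gt0// le_max lexx.
have d2 : d ^+ 2 / 2 <= alpha.
  by apply: le_trans alpha_ge; rewrite ler_pM2r ?invr_gt0// le_max lexx orbT.
split=> [c0 _ _ K1 _|d0 _ _ K1 _]; split=> _.
- exists (fun eps x => Qinv alpha eps c d (F x)) => eps eps0.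
  have [Q_itv Q_inc] := Qinv_spec eps0 d2 c0 hcd (K1 _ eps0).
  split=> // [x xI|x y /set_mem xI /set_mem yI xy]; first exact/Q_itv/F01.
  by apply: Q_inc; [exact: F01|exact: F01|exact: F_inc].
- exists (fun eps x => Qinv alpha eps c d (1 - F x)) => eps eps0.
  have [Q_itv Q_inc] := Qinv_spec eps0 d2 c0 hcd (K1 _ eps0).
  split=> // [x xI|x y /set_mem xI /set_mem yI xy]; first exact/Q_itv/NF01.
  apply: Q_inc; [exact: NF01|exact: NF01|].
  by rewrite ltrD2l ltrN2; exact: F_inc.
- exists (fun eps x => Rmapinv alpha eps c d (F x)) => eps eps0.
  have [R_itv R_inc] := Rmapinv_spec eps0 c2 hcd d0 (K1 _ eps0).
  split=> // [x xI|x y /set_mem xI /set_mem yI xy]; first exact/R_itv/F01.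
  by apply: R_inc; [exact: F01|exact: F01|exact: F_inc].
- exists (fun eps x => Rmapinv alpha eps c d (1 - F x)) => eps eps0.
  have [R_itv R_inc] := Rmapinv_spec eps0 c2 hcd d0 (K1 _ eps0).
  split=> // [x xI|x y /set_mem xI /set_mem yI xy]; first exact/R_itv/NF01.
  apply: R_inc; [exact: NF01|exact: NF01|].
  by rewrite ltrD2l ltrN2; exact: F_inc.
Qed.
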